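(* Let $f,\varphi_1,\varphi_2\in\mathcal{S}^{(1)}(\mathbb{R}^d)$ and $a\in\mathcal{S}^{(1)'}(\mathbb{R}^{2d})$. Then the localization operator defined by $$A_a^{\varphi_1,\varphi_2}f(t)=\int_{\mathbb{R}^{2d}}a(x,\omega)\,R_{\check\varphi_1}f\left(\tfrac x2,\tfrac\omega2\right)\,R(\check\varphi_2(t))\left(\tfrac x2,\tfrac\omega2\right)\,dx\,d\omega$$ coincides with the usual localization operator defined by means of the short-time Fourier transform, $$\tilde A_a^{\varphi_1,\varphi_2}f(t)=\int_{\mathbb{R}^{2d}}a(x,\omega)\,V_{\varphi_1}f(x,\omega)\,M_\omega T_x\varphi_2(t)\,dx\,d\omega .$$
   Context: $\mathcal{S}^{(1)}(\mathbb{R}^d)=\Sigma_1^1(\mathbb{R}^d)$ is the Gelfand-Shilov space of all $f\in C^\infty(\mathbb{R}^d)$ such that for all $A,B>0$ there is $C>0$ with $\|x^\alpha\partial^\beta f\|_{L^\infty}\le CA^{|\alpha|}|\alpha|!\,B^{|\beta|}|\beta|!$ for all $\alpha,\beta\in\mathbb{N}_0^d$, with its projective limit topology; $\mathcal{S}^{(1)'}$ is its dual. $\check\varphi(t)=\varphi(-t)$. Grossmann-Royer operator: $R(f(t))(x,\omega)=e^{4\pi i\omega\cdot(t-x)}f(2x-t)$; Grossmann-Royer transform: $R_gf(x,\omega)=\int e^{4\pi i\omega\cdot(t-x)}f(2x-t)\overline{g(t)}\,dt$; short-time Fourier transform: $V_gf(x,\omega)=\int e^{-2\pi it\cdot\omega}f(t)\overline{g(t-x)}\,dt$;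 $T_xf(t)=f(t-x)$, $M_\omega f(t)=e^{2\pi i\omega\cdot t}f(t)$. Both operators are continuous from $\mathcal{S}^{(1)}(\mathbb{R}^d)$ to $\mathcal{S}^{(1)'}(\mathbb{R}^d)$ and the integrals are understood in the weak sense: for $g\in\mathcal{S}^{(1)}(\mathbb{R}^d)$, $\langle A_a^{\varphi_1,\varphi_2}f,g\rangle=\langle a(x,\omega)R_{\check\varphi_1}f(\frac x2,\frac\omega2),R_{\check\varphi_2}g(\frac x2,\frac\omega2)\rangle$ and $\langle\tilde A_a^{\varphi_1,\varphi_2}f,g\rangle=\langle a\,V_{\varphi_1}f,V_{\varphi_2}g\rangle$, where $\langle\cdot,\cdot\rangle$ extends the inner product $\langle f,g\rangle=\int f\overline g$. *)

(* Defs.v *)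
From HB Require Import structures.
From mathcomp Require Import all_boot all_order all_algebra.
From mathcomp Require Import complex.
From mathcomp Require Import all_classical all_reals all_analysis.

Set Implicit Arguments.
Unset Strict Implicit.
Unset Printing Implicit Defensive.

Import Order.TTheory GRing.Theory Num.Theory.
Import numFieldNormedType.Exports.

Local Open Scope classical_set_scope.
Local Open Scope ring_scope.
Local Open Scope complex_scope.

Section LebesgueTuple.
Context {R : realType}.
Local Notation RT := (measurableTypeR R).

Definition tcons n (p : RT * n.-tuple RT) : n.+1.-tuple RT :=
  [the n.+1.-tuple RT of p.1 :: p.2].

Definition tuncons n (t : n.+1.-tuple RT) : RT * n.-tuple RT :=
  (thead t, [tuple of behead t]).

Lemma measurable_tcons n : measurable_fun [set: RT * n.-tuple RT] (@tcons n).
Proof. exact: (@measurable_cons _ _ _ _ fst n snd). Qed.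

Lemma measurable_tuncons n : measurable_fun [set: n.+1.-tuple RT] (@tuncons n).
Proof.
apply/measurable_fun_pairP; split.
  exact: measurable_tnth.
exact: measurable_behead.
Qed.

Lemma tconsK n : cancel (@tcons n) (@tuncons n).
Proof. by case=> x t; congr (_, _); apply/val_inj. Qed.

Section Step.
Variables (n : nat) (m : {sigma_finite_measure set (n.-tuple RT) -> \bar R}).

Definition leb_step : set (n.+1.-tuple RT) -> \bar R :=
  pushforward (lebesgue_measure \x m)%E (@tcons n).

HB.instance Definition _ := Measure.copy leb_step
  (@measure_function_pushforward__canonical__measure_function_Measure
    _ _ _ _ _ (lebesgue_measure \x m)%E _ (@measurable_tcons n)).

Lemma sigma_finite_leb_step : sigma_finite setT leb_step.
Proof.
have /sigma_finiteP[F [TF ndF Foo]] := sigma_finiteT (@lebesgue_measure R).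
have /sigma_finiteP[G [TG ndG Goo]] := sigma_finiteT m.
exists (fun k => @tuncons n @^-1` (F k `*` G k)).
  rewrite -preimage_bigcup; apply/esym/seteqP; split => // t _.
  have [k1 _ Fk1] : (\bigcup_k F k) (thead t) by rewrite -TF.
  have [k2 _ Gk2] : (\bigcup_k G k) [tuple of behead t] by rewrite -TG.
  exists (maxn k1 k2) => //; split => /=.
  - by move: Fk1; apply/subsetPset/ndF/leq_maxl.
  - by move: Gk2; apply/subsetPset/ndG/leq_maxr.
move=> k; have [mFk Fkoo] := Foo k; have [mGk Gkoo] := Goo k.
have mFG : measurable (F k `*` G k) by exact: measurableX.
split; first by rewrite -[X in measurable X]setTI; exact: measurable_tuncons.
rewrite /leb_step /pushforward -comp_preimage.
rewrite (_ : _ \o _ = id) ?preimage_id; last first.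
  by apply/funext => p/=; rewrite tconsK.
by rewrite /= product_measure1E// lte_mul_pinfty// ge0_fin_numE.
Qed.

HB.instance Definition _ :=
  Measure_isSigmaFinite.Build _ _ _ leb_step sigma_finite_leb_step.

End Step.

(* Lebesgue measure on R^n, as the iterated product of the Lebesgue measure
   on R. *)
Fixpoint lebesgue_tuple n : {sigma_finite_measure set (n.-tuple RT) -> \bar R} :=
  match n with
  | 0 => \d_([tuple] : 0.-tuple RT)
  | n'.+1 => leb_step (lebesgue_tuple n')
  end.

Lemma lebesgue_tuple_box n (A : 'I_n -> set RT) :
  (forall i, measurable (A i)) ->
  lebesgue_tuple n [set t | forall i, A i (tnth t i)] =
  (\prod_(i < n) lebesgue_measure (A i))%E.
Proof.
elim: n A => [|n IH] A mA /=.
  rewrite big_ord0 diracE mem_set//= => -[].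
  by [].
rewrite /leb_step /pushforward big_ord_recl -IH//.
rewrite -product_measure1E//=; last first.
  rewrite (_ : [set _ | _] =
      \bigcap_(i : 'I_n) ((@tnth n RT)^~ i @^-1` A (lift ord0 i))).
    apply: fin_bigcap_measurable => // i _.
    by rewrite -[X in measurable X]setTI; exact: measurable_tnth.
  by apply/seteqP; split=> [t At i _|t At i]; exact: At.
congr (_ _); apply/seteqP; split => -[x t]/= => [H|[Ax At] i].
  by split=> [|i]; [exact: H ord0|have := H (lift ord0 i); rewrite tnthS].
have [j ->|->//] := unliftP ord0 i.
by rewrite tnthS; exact: At.
Qed.

End LebesgueTuple.

Section GelfandShilov.
Context {R : realType} {d : nat}.
Local Notation Re := (@complex.Re R).
Local Notation Im := (@complex.Im R).
Local Notation V := 'rV[R]_d.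
Implicit Types (f g : V -> R) (F G : V -> R[i]).

(* Iterated partial derivatives, the head of [s] being taken last. *)
Definition partial (s : seq 'I_d) f : V -> R :=
  foldr (fun i h => 'D_(delta_mx 0 i) h) f s.

(* C^oo: all iterated partial derivatives exist and are continuous. *)
Definition smooth f := forall s : seq 'I_d,
  continuous (partial s f) /\
  forall (i : 'I_d) (x : V), derivable (partial s f) x (delta_mx 0 i).

Definition csmooth F := smooth (Re \o F) /\ smooth (Im \o F).

Definition mindeg (a : 'I_d -> nat) : nat := (\sum_i a i)%N.

Definition monom (a : 'I_d -> nat) (x : V) : R := \prod_i x 0 i ^+ a i.

Definition cpartial (b : 'I_d -> nat) F : V -> R[i] :=
  let s := flatten [seq nseq (b i) i | i <- enum 'I_d] in
  fun x => partial s (Re \o F) x +i* partial s (Im \o F) x.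

(* sup |x^a d^b F| <= C A^|a| |a|! B^|b| |b|! for all a, b.  The inequality is
   in R[i], between real numbers; as x^a d^b F is continuous, its L^oo norm is
   its supremum. *)
Definition gs_bound (A B C : R) F := forall (a b : 'I_d -> nat) (x : V),
  `|(monom a x)%:C * cpartial b F x| <=
  (C * (A ^+ mindeg a * (mindeg a)`!%:R) * (B ^+ mindeg b * (mindeg b)`!%:R))%:C.

Definition is_gs F := csmooth F /\
  forall A B : R, 0 < A -> 0 < B -> exists2 C : R, 0 < C & gs_bound A B C F.

Lemma partial_lin f g (s : seq 'I_d) (k l : R) : smooth f -> smooth g ->
  partial s (fun x => k * f x + l * g x) =
  (fun x => k * partial s f x + l * partial s g x).
Proof.
move=> sf sg; elim: s => [//|i s IH] /=; rewrite IH; apply/funext => x.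
have [_ df] := sf s; have [_ dg] := sg s.
rewrite [LHS](@deriveD _ _ _ (k \*: partial s f) (l \*: partial s g)).
- by rewrite !deriveZ.
- exact/derivableZ/df.
- exact/derivableZ/dg.
Qed.

Lemma smooth_lin f g (k l : R) : smooth f -> smooth g ->
  smooth (fun x => k * f x + l * g x).
Proof.
move=> sf sg s; rewrite partial_lin//.
have [cf df] := sf s; have [cg dg] := sg s.
split=> [x|i x].
  apply: (@continuousD _ _ _ (fun y => k * partial s f y)
    (fun y => l * partial s g y)).
    by apply: continuousM; [exact: cst_continuous|exact: cf].
  by apply: continuousM; [exact: cst_continuous|exact: cg].
apply: (@derivableD _ _ _ (k \*: partial s f) (l \*: partial s g)).
  exact/derivableZ/df.
exact/derivableZ/dg.
Qed.

Lemma Re_lin (c : R[i]) F G : Re \o (c *: F + G) =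
  (fun x => 1 * (Re c * (Re \o F) x +
     (- Im c) * (Im \o F) x) + 1 * (Re \o G) x).
Proof.
apply/funext => x /=; rewrite fctE /= !mul1r.
rewrite -[(c *: F) x]/(c * F x).
by case: c (F x) (G x) => [a b] [u v] [p q] /=; rewrite ?mulNr.
Qed.

Lemma Im_lin (c : R[i]) F G : Im \o (c *: F + G) =
  (fun x => 1 * (Re c * (Im \o F) x +
     Im c * (Re \o F) x) + 1 * (Im \o G) x).
Proof.
apply/funext => x /=; rewrite fctE /= !mul1r.
rewrite -[(c *: F) x]/(c * F x).
by case: c (F x) (G x) => [a b] [u v] [p q] /=; rewrite ?mulNr.
Qed.

Lemma csmooth_lin (c : R[i]) F G :
  csmooth F -> csmooth G -> csmooth (c *: F + G).
Proof.
move=> [sRF sIF] [sRG sIG]; split; rewrite ?Re_lin ?Im_lin;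
  by apply: smooth_lin => //; exact: smooth_lin.
Qed.

Lemma cpartial_lin b (c : R[i]) F G : csmooth F -> csmooth G ->
  cpartial b (c *: F + G) = c *: cpartial b F + cpartial b G.
Proof.
move=> [sRF sIF] [sRG sIG]; apply/funext => x.
rewrite /cpartial Re_lin Im_lin.
have lin3 s f g h (k l : R) : smooth f -> smooth g -> smooth h ->
    partial s (fun y => 1 * (k * f y + l * g y) + 1 * h y) x =
    k * partial s f x + l * partial s g x + partial s h x.
  move=> sf sg sh; rewrite partial_lin//; last exact: smooth_lin.
  by rewrite partial_lin// !mul1r.
rewrite !lin3// -[RHS]/(c * cpartial b F x + cpartial b G x) /cpartial.
by case: c => u v /=; rewrite mulNr.
Qed.

Lemma gs_boundD A B C1 C2 (c : R[i]) F G : csmooth F -> csmooth G ->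
  gs_bound A B C1 F -> gs_bound A B C2 G ->
  gs_bound A B (Re `|c| * C1 + C2) (c *: F + G).
Proof.
move=> sF sG bF bG a b x; rewrite cpartial_lin//.
rewrite -[(_ + _) x]/(c * cpartial b F x + cpartial b G x) mulrDr.
apply: (le_trans (ler_normD _ _)).
set K := A ^+ _ * _; set L := B ^+ _ * _.
have -> : (Re `|c| * C1 + C2) * K * L =
    Re `|c| * (C1 * K * L) + C2 * K * L by rewrite !mulrDl !mulrA.
have E (u v : R) : (Re `|c| * u + v)%:C = `|c| * u%:C + v%:C :> R[i].
  by rewrite normc_def; apply/eqP; rewrite eq_complex/= !(mulr0, mul0r, addr0, subr0) !eqxx.
by rewrite E lerD ?bG// mulrCA normrM ler_wpM2l//; exact: bF.
Qed.

Lemma partial0 s : partial s (cst 0) = cst 0.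
Proof. by elim: s => [//|i s /= ->]; apply/funext => y; rewrite derive_cst. Qed.

Lemma csmooth0 : csmooth 0.
Proof.
by split=> s; rewrite (_ : _ \o _ = cst 0)// partial0; split=> [x|i x];
  [exact: cst_continuous|exact: derivable_cst|
   exact: cst_continuous|exact: derivable_cst].
Qed.

Lemma gs_bound0 A B C : 0 < A -> 0 < B -> 0 < C -> gs_bound A B C 0.
Proof.
move=> A0 B0 C0 a b x; rewrite /cpartial.
rewrite (_ : Re \o 0 = cst 0)// (_ : Im \o 0 = cst 0)// partial0 mulr0 normr0.
by rewrite lecR ltW// ?mulr_gt0 ?exprn_gt0 ?ltr0n ?fact_gt0.
Qed.

Lemma gs_bound_le A B C A' B' C' F :
  0 < A -> 0 < B -> 0 < C -> A <= A' -> B <= B' -> C <= C' ->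
  gs_bound A B C F -> gs_bound A' B' C' F.
Proof.
move=> A0 B0 C0 AA BB CC bF a b x; apply: le_trans (bF a b x) _.
have K (D D' : R) n : 0 < D -> D <= D' ->
    0 <= D ^+ n * n`!%:R <= D' ^+ n * n`!%:R.
  move=> /ltW D0 DD; apply/andP; split; first by rewrite mulr_ge0// exprn_ge0.
  by apply: ler_wpM2r => //; rewrite lerXn2r// nnegrE (le_trans D0).
have /andP[KA0 KA] := K _ _ (mindeg a) A0 AA.
have /andP[KB0 KB] := K _ _ (mindeg b) B0 BB.
rewrite lecR; apply: ler_pM => //; first by rewrite mulr_ge0// ltW.
by apply: ler_pM => //; exact: ltW.
Qed.

Definition gs : {pred V -> R[i]} := fun F => `[< is_gs F >].

Lemma gs_submod : submod_closed gs.
Proof. 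
split.
  apply/asboolP; split=> [|A B A0 B0]; first exact: csmooth0.
  by exists 1 => //; exact: gs_bound0.
move=> c F G /asboolP[sF bF] /asboolP[sG bG]; apply/asboolP.
split=> [|A B A0 B0]; first exact: csmooth_lin.
have [C1 C10 bF1] := bF _ _ A0 B0; have [C2 C20 bG2] := bG _ _ A0 B0.
exists (Re `|c| * C1 + C2); last exact: gs_boundD.
rewrite ltr_wpDl// mulr_ge0//; last exact: ltW.
by rewrite normc_def sqrtr_ge0.
Qed.
HB.instance Definition _ := GRing.isSubmodClosed.Build R[i] (V -> R[i]) gs gs_submod.

End GelfandShilov.
Arguments gs R d : clear implicits.

Section GelfandShilovSpace.
Variables (R : realType) (d : nat).

Record GS := mkGS { gs_fun :> 'rV[R]_d -> R[i]; _ : gs_fun \in gs R d }.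

HB.instance Definition _ := [isSub for gs_fun].
HB.instance Definition _ := [Choice of GS by <:].
HB.instance Definition _ := [SubChoice_isSubLmodule of GS by <:].

(* [gs_bound A B e F] says that the norm
     sup_(a, b, x) |x^a d^b F(x)| / (A^|a| |a|! B^|b| |b|!)
   is at most e.  S^(1) is the projective limit over A, B > 0 of the normed
   spaces these norms define.  They increase when A and B decrease, so the balls
   for single pairs (A, B) are a base of neighbourhoods. *)
Definition gs_ball (A B e : R) (f : GS) : set GS :=
  [set g : GS | gs_bound A B e (g - f)].

Definition gs_nbhs (f : GS) : set_system GS :=
  filter_from [set p : R * R * R | [/\ 0 < p.1.1, 0 < p.1.2 & 0 < p.2]]
   (fun p => gs_ball p.1.1 p.1.2 p.2 f).

HB.instance Definition _ := hasNbhs.Build GS gs_nbhs.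

Lemma gs_csmooth (f : GS) : csmooth f.
Proof. by case: f => f /= /asboolP[]. Qed.

Lemma gs_ball_center A B e f : 0 < A -> 0 < B -> 0 < e -> gs_ball A B e f f.
Proof. by move=> A0 B0 e0; rewrite /gs_ball /mkset subrr; exact: gs_bound0. Qed.

Lemma gs_ball_triangle A B e1 e2 f g h :
  gs_ball A B e1 f g -> gs_ball A B e2 g h -> gs_ball A B (e1 + e2) f h.
Proof.
rewrite /gs_ball /mkset => fg gh.
have -> : h - f = 1 *: (g - f) + (h - g) by rewrite scale1r [RHS]addrC addrA subrK.
have := @gs_boundD _ _ A B e1 e2 1 _ _
  (gs_csmooth (g - f)) (gs_csmooth (h - g)) fg gh.
by rewrite normr1 mul1r.
Qed.

Lemma gs_nbhs_filter f : ProperFilter (gs_nbhs f).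
Proof.
apply: filter_from_proper => [|[[A B] e] /= [A0 B0 e0]]; last first.
  by exists f; exact: gs_ball_center.
apply: filter_from_filter; first by exists (1, 1, 1).
move=> [[A B] e] [[A' B'] e'] /= [A0 B0 e0] [A0' B0' e0'].
exists (Num.min A A', Num.min B B', Num.min e e').
  by split; rewrite lt_min ?A0 ?B0 ?e0.
move=> g /= fg; split; apply: gs_bound_le fg;
  by rewrite ?lt_min ?ge_min ?lexx ?orbT ?A0 ?B0 ?e0.
Qed.

Lemma gs_nbhs_singleton f (U : set GS) : gs_nbhs f U -> U f.
Proof.
by move=> [[[A B] e]] /= [A0 B0 e0]; apply; exact: gs_ball_center.
Qed.

Lemma gs_nbhs_nbhs f (U : set GS) : gs_nbhs f U -> gs_nbhs f (gs_nbhs^~ U).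
Proof.
move=> [[[A B] e]] /= [A0 B0 e0] fU.
exists (A, B, e / 2) => /=; first by rewrite divr_gt0.
move=> g fg; exists (A, B, e / 2) => /=; first by rewrite divr_gt0.
by move=> h gh; apply: fU; rewrite [e]splitr; exact: gs_ball_triangle gh.
Qed.

HB.instance Definition _ := Nbhs_isNbhsTopological.Build GS
  gs_nbhs_filter gs_nbhs_singleton gs_nbhs_nbhs.

(* The pairing <u, g> of S^(1)' with S^(1) extends the inner product
   \int u (conj g), hence it is conjugate-linear in g. *)
Record gs_dual := mkGSDual {
  gs_functional :> {linear GS -> R[i] | (Num.conj \; *%R)};
  gs_functional_continuous : continuous (gs_functional : GS -> R[i]^o) }.

(* <u F, G> = <u, (conj F) G> for functions F and G.  [insubd] turns (conj F) G
   into an element of S^(1); its default value 0, for functions outside S^(1), is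
   never used below: there (conj F) G is (conj (V_phi1 f)) (V_phi2 g), a product
   of elements of the algebra S^(1)(R^2d), or the same function written with
   Grossmann-Royer transforms. *)
Definition mul_pairing (u : gs_dual) (F G : 'rV[R]_d -> R[i]) : R[i] :=
  u (insubd (0 : GS) (fun x => Num.conj (F x) * G x)).

End GelfandShilovSpace.

Section TimeFrequency.
Context {R : realType} {d : nat}.
Local Notation V := 'rV[R]_d.
Implicit Types (f g : V -> R[i]) (x w t : V).

Definition dot w t : R := \sum_i w 0 i * t 0 i.

Definition expi (theta : R) : R[i] := cos theta +i* sin theta.

Definition cintegral f : R[i] :=
  let F (t : d.-tuple (measurableTypeR R)) := f (\row_i tnth t i) in
  (\int[lebesgue_tuple d]_t complex.Re (F t)) +i*
  (\int[lebesgue_tuple d]_t complex.Im (F t)).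

Definition reflection f : V -> R[i] := fun t => f (- t).

Definition grossmann_royer_op f x w : V -> R[i] :=
  fun t => expi (4 * pi * dot w (t - x)) * f (2 *: x - t).

Definition grossmann_royer g f x w : R[i] :=
  cintegral (fun t => grossmann_royer_op f x w t * Num.conj (g t)).

Definition stft g f x w : R[i] :=
  cintegral (fun t => expi (- (2 * pi * dot t w)) * f t * Num.conj (g (t - x))).

End TimeFrequency.

(* A point z of the phase space R^2d is row_mx x w with x = lsubmx z and
   w = rsubmx z.  The operators
     \int a(z) R_(phi1~) f(x/2, w/2) R(phi2~)(x/2, w/2) dz     (phi~ reflected)
     \int a(z) V_phi1 f(z) M_w T_x phi2 dz
   are weak integrals, with values in S^(1)'(R^d): pairing with g turns the
   kernels into the transforms of g, with windows phi2~ and phi2, in the second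
   argument of the pairing with a. *)
Section LocalizationOperators.
Context {R : realType} {d : nat}.
Variables (a : gs_dual R (d + d)) (phi1 phi2 f : GS R d).

Definition locop_grossmann_royer : GS R d -> R[i] := fun g =>
  let half_royer (phi h : GS R d) (z : 'rV[R]_(d + d)) :=
    grossmann_royer (reflection phi) h
      (2^-1 *: lsubmx z) (2^-1 *: rsubmx z) in
  mul_pairing a (half_royer phi1 f) (half_royer phi2 g).

Definition locop_stft : GS R d -> R[i] := fun g =>
  let stft2 (phi h : GS R d) (z : 'rV[R]_(d + d)) :=
    stft phi h (lsubmx z) (rsubmx z) in
  mul_pairing a (stft2 phi1 f) (stft2 phi2 g).

End LocalizationOperators.

(* Main.v *)
(* Substituting t -> x - t in the Grossmann-Royer integral at (x/2, w/2) with
   the reflected window gives exp(pi i w.x) times the short-time Fourier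
   transform at (x, w).  This unimodular factor depends neither on the window
   nor on the function, so it cancels against its conjugate in (conj F) G, and a
   is paired with the same test function on both sides.  Taking the factor out
   of the integral needs integrability of the kernel, which comes from the decay
   of f, at least as fast as prod_i (1 + t_i^2)^-1. *)
Require Import Defs.
From mathcomp Require Import all_boot all_order all_algebra.
From mathcomp Require Import complex.
From mathcomp Require Import all_classical all_reals all_analysis.
From mathcomp Require Import measurable_realfun ring.

Set Implicit Arguments.
Unset Strict Implicit.
Unset Printing Implicit Defensive.

Import Order.TTheory GRing.Theory Num.Theory.
Import numFieldNormedType.Exports.

Local Open Scope classical_set_scope.
Local Open Scope ring_scope.

(** * Tonelli, reflection and an integrable weight for the Lebesgue measure on tuples *)

Section LebesgueTupleIntegral.
Context {R : realType}.
Local Notation RT := (measurableTypeR R).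
Local Notation mu := (@lebesgue_measure R).
Local Open Scope ereal_scope.

(** Each step of [lebesgue_tuple] is the pushforward of a product measure along [tcons], so this is
    Tonelli's theorem after a change of variables. *)
Lemma ge0_integral_lebesgue_tupleS n (g : n.+1.-tuple RT -> \bar R) :
  measurable_fun [set: _.-tuple RT] g -> (forall t, 0 <= g t) ->
  \int[lebesgue_tuple n.+1]_t g t =
  \int[mu]_x \int[lebesgue_tuple n]_t g (tcons (x, t)).
Proof.
move=> mg g0.
transitivity (\int[pushforward (mu \x lebesgue_tuple n) (@tcons R n)]_t g t).
  by [].
rewrite (ge0_integral_pushforward (@measurable_tcons R n))//.
rewrite preimage_setT fubini_tonelli1//.
  exact: measurableT_comp mg (@measurable_tcons R n).
by move=> t; exact: g0.
Qed.

(** The pushforward of the Lebesgue measure under the reflection gives every interval []a, b]] its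
    length, so it is the Lebesgue measure by uniqueness. *)
Lemma ge0_integral_reflect (c : R) (g : RT -> \bar R) :
  measurable_fun [set: RT] g -> (forall x, 0 <= g x) ->
  \int[mu]_x g (c - x)%R = \int[mu]_x g x.
Proof.
move=> mg g0.
have mr : measurable_fun [set: RT] (fun x : RT => (c - x)%R : RT).
  exact: measurable_funB.
transitivity (\int[pushforward mu (fun x : RT => (c - x)%R : RT)]_x g x).
  by rewrite (ge0_integral_pushforward mr).
apply: eq_measure_integral => A mA _; apply/esym.
apply: (@lebesgue_measure_unique R) => // _ [[a b]] _ <-.
rewrite /= /pushforward.
(* The reflection reverses the order, so the closed end moves to the left; the length is
   unchanged. *)
have -> : (fun x : RT => (c - x)%R : RT) @^-1` `]a, b] =
    `[(c - b)%R, (c - a)%R[%classic.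
  apply/seteqP; split => x /=; rewrite !in_itv/= => /andP[h1 h2]; apply/andP.
    by split; [rewrite lerBlDl -lerBlDr|rewrite ltrBrDl -ltrBrDr].
  by split; [rewrite ltrBrDl -ltrBrDr|rewrite lerBlDl -lerBlDr].
rewrite !lebesgue_measure_itv/= !lte_fin ltrD2l ltrN2 -!EFinB.
by rewrite -[(b - a)%R](subrKA c) [(b - c + _)%R]addrC opprB.
Qed.

Definition tuple_reflect n (c : n.-tuple RT) (t : n.-tuple RT) : n.-tuple RT :=
  [tuple (tnth c i - tnth t i)%R | i < n].

Lemma measurable_tuple_reflect n (c : n.-tuple RT) :
  measurable_fun [set: n.-tuple RT] (tuple_reflect c).
Proof.
apply/measurable_fun_tnthP => i.
rewrite (_ : _ \o _ = fun t => (tnth c i - tnth t i)%R).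
  by apply: measurable_funB => //; exact: measurable_tnth.
by apply/funext => t; rewrite /= tnth_mktuple.
Qed.

Lemma tuple_reflect_tcons n (c : n.+1.-tuple RT) x (t : n.-tuple RT) :
  tuple_reflect c (tcons (x, t)) =
  tcons ((thead c - x)%R, tuple_reflect ([tuple of behead c] : n.-tuple RT) t).
Proof.
apply: eq_from_tnth => i; rewrite [LHS]tnth_mktuple.
have [j ->|->] := unliftP ord0 i; last by rewrite !tnth0.
rewrite /tcons !tnthS tnth_mktuple tnth_behead; congr (tnth c _ - _)%R.
by apply/val_inj; rewrite /= inordK// ltnS.
Qed.

(** Induction on the dimension: Tonelli splits off the first coordinate, which is reflected by the
    one-dimensional case, and the remaining ones by the induction hypothesis. *)
Lemma ge0_integral_tuple_reflect n (c : n.-tuple RT)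
    (g : n.-tuple RT -> \bar R) :
  measurable_fun [set: _.-tuple RT] g -> (forall t, 0 <= g t) ->
  \int[lebesgue_tuple n]_t g (tuple_reflect c t) =
  \int[lebesgue_tuple n]_t g t.
Proof.
elim: n c g => [|n IH] c g mg g0.
  by apply: eq_integral => t _; rewrite (tuple0 t) (tuple0 (tuple_reflect _ _)).
rewrite !ge0_integral_lebesgue_tupleS//; last first.
  exact: measurableT_comp mg (measurable_tuple_reflect c).
have mgc : measurable_fun [set: RT * n.-tuple RT] (g \o @tcons R n).
  exact: measurableT_comp mg (@measurable_tcons R n).
rewrite -[RHS](ge0_integral_reflect (thead c)); last 2 first.
- exact: (measurable_fun_fubini_tonelli_F (m2 := lebesgue_tuple n) _ mgc
    (fun p => g0 (tcons p))).
- by move=> x; apply: integral_ge0.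
apply: eq_integral => x _.
rewrite -[RHS](IH ([tuple of behead c] : n.-tuple RT))//.
  by apply: eq_integral => t _; rewrite tuple_reflect_tcons.
exact: measurableT_comp mgc (measurable_pair1 _).
Qed.

Lemma integral_tuple_reflect n (c : n.-tuple RT) (g : n.-tuple RT -> \bar R) :
  measurable_fun [set: n.-tuple RT] g ->
  \int[lebesgue_tuple n]_t g (tuple_reflect c t) =
  \int[lebesgue_tuple n]_t g t.
Proof.
move=> mg; rewrite [LHS]integralE [RHS]integralE.
rewrite -(ge0_integral_tuple_reflect c (measurable_funepos mg) (funepos_ge0 g)).
rewrite -(ge0_integral_tuple_reflect c (measurable_funeneg mg) (funeneg_ge0 g)).
by congr (_ - _); apply: eq_integral => t _; rewrite ?funeposE ?funenegE.
Qed.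

(** By evenness it is twice the integral over the half-line, whose value is known. *)
Lemma integral_oneDsqrV_lty : \int[mu]_x ((oneDsqr x)^-1)%:E < +oo.
Proof.
rewrite ge0_symfun_integralT//.
- by rewrite -set_itvcy integral0y_oneDsqr -EFinM ltry.
- exact: continuous_oneDsqrV.
- by move=> x; rewrite /oneDsqr /= sqrrN.
Qed.

(** The majorant for domination arguments; the product form lets its integral factor over the
    coordinates. *)
Definition tuple_weight n (t : n.-tuple RT) : R :=
  (\prod_(i < n) (oneDsqr (tnth t i))^-1)%R.

Lemma tuple_weight_gt0 n (t : n.-tuple RT) : (0 < tuple_weight t)%R.
Proof.
by apply: prodr_gt0 => i _; rewrite invr_gt0 (lt_le_trans _ (oneDsqr_ge1 _)).
Qed.

Lemma measurable_oneDsqrV :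
  measurable_fun [set: RT] (fun x : RT => (oneDsqr x)^-1%R).
Proof. by apply: continuous_measurable_fun; exact: continuous_oneDsqrV. Qed.

Lemma measurable_tuple_weight n :
  measurable_fun [set: n.-tuple RT] (@tuple_weight n).
Proof.
apply: measurable_prod => i _.
exact: measurableT_comp measurable_oneDsqrV (measurable_tnth i).
Qed.

Lemma integrable_tuple_weight n :
  (lebesgue_tuple n).-integrable [set: n.-tuple RT] (EFin \o @tuple_weight n).
Proof.
apply/integrableP; split.
  by apply/measurable_EFinP; exact: measurable_tuple_weight.
under eq_integral do rewrite gee0_abs ?lee_fin ?(ltW (tuple_weight_gt0 _))//.
elim: n => [|n IH].
  rewrite integral_dirac//; first by rewrite diracT mul1e ltry.
  by apply/measurable_EFinP; exact: measurable_tuple_weight.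
rewrite ge0_integral_lebesgue_tupleS; last 2 first.
- by apply/measurable_EFinP; exact: measurable_tuple_weight.
- by move=> t; rewrite lee_fin ltW// tuple_weight_gt0.
have -> : \int[mu]_x \int[lebesgue_tuple n]_t (tuple_weight (tcons (x, t)))%:E =
    \int[mu]_x (((oneDsqr x)^-1)%:E *
                \int[lebesgue_tuple n]_t (tuple_weight t)%:E).
  apply: eq_integral => x _; rewrite -ge0_integralZl//.
  - apply: eq_integral => t _; rewrite /tuple_weight big_ord_recl EFinM /=.
    by congr (_ * (_)%:E); apply: eq_bigr => i _; rewrite tnthS.
  - by apply/measurable_EFinP; exact: measurable_tuple_weight.
  - by move=> t _; rewrite lee_fin ltW// tuple_weight_gt0.
rewrite ge0_integralZr//; last 2 first.
- by apply/measurable_EFinP; exact: measurable_oneDsqrV.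
- by apply: integral_ge0 => t _; rewrite lee_fin ltW// tuple_weight_gt0.
rewrite lte_mul_pinfty//; first exact: integral_ge0.
  rewrite ge0_fin_numE ?integral_oneDsqrV_lty//.
  apply: integral_ge0 => x _.
  by rewrite lee_fin invr_ge0 (le_trans _ (oneDsqr_ge1 x)).
Qed.

End LebesgueTupleIntegral.

(** * Borel measurability of continuous functions, seen through tuples *)

Section ContinuousTuple.
Context {R : realType}.
Local Notation RT := (measurableTypeR R).

Definition row_of_tuple n (t : n.-tuple R) : 'rV[R]_n := \row_i tnth t i.

(* An open set of rows is the union of the cubes with rational center and
   radius [k.+1^-1] that it contains, and there are countably many of them. *)
Lemma measurable_row_of_tuple n (U : set 'rV[R]_n) : open U ->
  measurable [set t : n.-tuple RT | U (row_of_tuple t)].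
Proof.
move=> oU.
pose center (q : {ffun 'I_n -> rat}) : 'rV[R]_n := \row_i ratr (q i).
pose cube (p : {ffun 'I_n -> rat} * nat) : set (n.-tuple RT) :=
  [set t | ball (center p.1) p.2.+1%:R^-1 `<=` U /\
           forall i, ball (center p.1 0 i) p.2.+1%:R^-1 (tnth t i)].
have -> : [set t : n.-tuple RT | U (row_of_tuple t)] = \bigcup_p cube p.
  apply/seteqP; split=> [t Ut|t [[q k] _ /= [qU tq]]]; last first.
    apply: qU; split=> [|i j]; first by rewrite invr_gt0.
    by rewrite ord1 /row_of_tuple [X in ball _ _ X]mxE; exact: tq.
  have /nbhs_ballP[e /= e0 eU] : nbhs (row_of_tuple t) U.
    exact: open_nbhs_nbhs.
  (* The radius is below [e / 2] because a point [y] of the cube is compared with [t] through the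
     rational center, which is close to both. *)
  have [k ke] : exists k, k.+1%:R^-1 < e / 2 :> R.
    have e20 : 0 < e / 2 by rewrite divr_gt0.
    by have [k] := ltr_add_invr e20; rewrite add0r; exists k.
  have near i : exists q : rat, ball (tnth t i : R) k.+1%:R^-1 (ratr q : R).
    have /rat_in_itvoo[q /itvP qI] : tnth t i < tnth t i + k.+1%:R^-1 :> R.
      by rewrite ltrDl invr_gt0.
    exists q; rewrite /ball /= ltr_distlC qI andbT.
    rewrite (lt_trans _ (_ : tnth t i < ratr q)) ?qI//.
    by rewrite ltrBlDr ltrDl invr_gt0.
  pose q := [ffun i => projT1 (cid (near i))].
  have tq i : ball (center q 0 i) k.+1%:R^-1 (tnth t i).
    by apply: ball_sym; rewrite mxE ffunE; case: cid.
  exists (q, k) => //; split=> //= y [_ qy]; apply: eU; split=> // i j.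
  rewrite ord1 /row_of_tuple [X in ball X]mxE.
  apply: (@ball_splitl _ _ (center q 0 j)).
    by apply: ball_sym; apply: le_ball (tq j); exact: ltW.
  by apply: ball_sym; apply: le_ball (qy 0 j); exact: ltW.
apply: countable_bigcupT_measurable; first exact: countableP.
move=> [q k]; rewrite /cube/=.
(* A pair whose ball leaves [U] contributes the empty set; otherwise only the finitely many
   coordinate conditions remain. *)
have [qU|nqU] := pselect (ball (center q) k.+1%:R^-1 `<=` U); last first.
  by rewrite (_ : [set _ | _] = set0)//; apply/seteqP; split=> t // -[].
rewrite (_ : [set _ | _] = \bigcap_(i : 'I_n)
    ((@tnth n RT)^~ i @^-1` ball (center q 0 i) k.+1%:R^-1)); last first.
  apply/seteqP; split=> [t [_ tq] i _|t tq]; first exact: tq.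
  by split=> // i; exact: tq.
apply: fin_bigcap_measurable => // i _.
rewrite -[X in measurable X]setTI; apply: measurable_tnth => //.
exact: measurable_ball.
Qed.

(** Open intervals generate the Borel sets of the line, and their preimages under [f] are open. *)
Lemma continuous_measurable_row_of_tuple n (f : 'rV[R]_n -> R) :
  continuous f ->
  measurable_fun [set: n.-tuple RT] (fun t : n.-tuple RT => f (row_of_tuple t)).
Proof.
move=> cf; apply: (measurability _ (RGenOpens.measurableE R)).
move=> _ [_ [a [b ->]] <-]; rewrite setTI.
apply: (measurable_row_of_tuple (U := f @^-1` `]a, b[)).
by apply: open_comp; [move=> x _; exact: cf|exact: interval_open].
Qed.

End ContinuousTuple.

(** * Continuity, phases and norms of complex-valued functions *)

Section ComplexFunctions.
Context {R : realType} {d : nat}.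
Local Notation RT := (measurableTypeR R).
Local Notation V := 'rV[R]_d.
Local Open Scope complex_scope.
Implicit Types (F G : V -> R[i]).

(** Stated by components to match [csmooth] and [cintegral], which treat real and imaginary parts
    separately. *)
Definition ccontinuous F :=
  continuous (fun t => complex.Re (F t)) /\
  continuous (fun t => complex.Im (F t)).

Lemma ccontinuousM F G : ccontinuous F -> ccontinuous G ->
  ccontinuous (fun t => F t * G t).
Proof.
move=> [rF iF] [rG iG]; split.
  rewrite (_ : (fun _ => _) = (fun t =>
      complex.Re (F t) * complex.Re (G t) -
      complex.Im (F t) * complex.Im (G t))).
    move=> t; apply: (@continuousB _ _ _
      (fun t => complex.Re (F t) * complex.Re (G t))
      (fun t => complex.Im (F t) * complex.Im (G t))).
      by apply: continuousM; [exact: rF|exact: rG].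
    by apply: continuousM; [exact: iF|exact: iG].
  by apply/funext => t; case: (F t) (G t) => [a b] [u v].
rewrite (_ : (fun _ => _) = (fun t =>
    complex.Re (F t) * complex.Im (G t) + complex.Im (F t) * complex.Re (G t))).
  move=> t; apply: (@continuousD _ _ _
    (fun t => complex.Re (F t) * complex.Im (G t))
    (fun t => complex.Im (F t) * complex.Re (G t))).
    by apply: continuousM; [exact: rF|exact: iG].
  by apply: continuousM; [exact: iF|exact: rG].
by apply/funext => t; case: (F t) (G t) => [a b] [u v].
Qed.

Lemma ccontinuous_conj F :
  ccontinuous F -> ccontinuous (fun t => Num.conj (F t)).
Proof.
move=> [rF iF]; split.
  rewrite (_ : (fun _ => _) = (fun t => complex.Re (F t)))//.
  by apply/funext => t; case: (F t).
rewrite (_ : (fun _ => _) = (fun t => - complex.Im (F t))).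
  by move=> t; apply: (@continuousN _ _ _ (fun t => complex.Im (F t)));
    exact: iF.
by apply/funext => t; case: (F t).
Qed.

Lemma ccontinuous_comp F (g : V -> V) : continuous g -> ccontinuous F ->
  ccontinuous (fun t => F (g t)).
Proof.
move=> cg [rF iF].
by split=> t; [apply: (@continuous_comp _ _ _ g (fun t => complex.Re (F t)))|
  apply: (@continuous_comp _ _ _ g (fun t => complex.Im (F t)))];
  [exact: cg|exact: rF|exact: cg|exact: iF].
Qed.

Lemma ccontinuous_expi (g : V -> R) : continuous g ->
  ccontinuous (fun t => expi (g t)).
Proof.
move=> cg; split=> t /=.
  by apply: (@continuous_comp _ _ _ g cos); [exact: cg|exact: continuous_cos].
by apply: (@continuous_comp _ _ _ g sin); [exact: cg|exact: continuous_sin].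
Qed.

Lemma expiD (x y : R) : expi (x + y) = expi x * expi y.
Proof. by rewrite /expi cosD sinD; congr (_ +i* _); rewrite addrC. Qed.

Lemma expi0 : expi 0 = 1 :> R[i].
Proof. by rewrite /expi cos0 sin0. Qed.

Lemma conj_expi (x : R) : Num.conj (expi x) = expi (- x).
Proof. by rewrite /expi cosN sinN. Qed.

Lemma norm_expi (x : R) : `|expi x| = 1.
Proof. by rewrite normc_def /= cos2Dsin2 sqrtr1. Qed.

Lemma norm_Re_le (z : R[i]) (r : R) : `|z| <= r%:C -> `|complex.Re z| <= r.
Proof. by move=> zr; rewrite -lecR (le_trans (normc_ge_Re z)). Qed.

Lemma norm_Im_le (z : R[i]) (r : R) : `|z| <= r%:C -> `|complex.Im z| <= r.
Proof.
rewrite normc_def lecR; apply: le_trans.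
by rewrite -sqrtr_sqr ler_sqrt ?lerDr ?sqr_ge0// addr_ge0// sqr_ge0.
Qed.

Lemma ccontinuous_measurable F : ccontinuous F ->
  measurable_fun [set: d.-tuple RT]
    (fun t : d.-tuple RT => complex.Re (F (\row_i tnth t i))) /\
  measurable_fun [set: d.-tuple RT]
    (fun t : d.-tuple RT => complex.Im (F (\row_i tnth t i))).
Proof.
by move=> [rF iF]; split; [exact: continuous_measurable_row_of_tuple rF|
  exact: continuous_measurable_row_of_tuple iF].
Qed.

End ComplexFunctions.

(** * Boundedness and decay of Gelfand-Shilov functions *)

Section GelfandShilovDecay.
Context {R : realType} {d : nat}.
Local Notation V := 'rV[R]_d.
Local Open Scope complex_scope.

Lemma gs_ccontinuous (f : GS R d) : ccontinuous f.
Proof.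
have [sr si] := gs_csmooth f.
by split; [exact: (sr [::]).1|exact: (si [::]).1].
Qed.

(** The defining estimate at [A = B = 1] with no derivative: for the zero multi-index the list of
    directions in [cpartial] is empty. *)
Lemma gs_monom_le (f : GS R d) : exists2 C : R, 0 < C &
  forall (a : 'I_d -> nat) (x : V),
    `|(monom a x)%:C * f x| <= (C * (mindeg a)`!%:R)%:C.
Proof.
have [_ /(_ 1 1 ltr01 ltr01)[C C0 bf]] : is_gs f by apply/asboolP; case: f.
exists C => // a x; have := bf a (fun=> 0%N) x.
rewrite [mindeg (fun=> 0%N)]big1// !expr1n !mul1r fact0 mulr1 /cpartial.
rewrite (_ : flatten _ = [::]); last by elim: (enum 'I_d).
by rewrite /= (_ : _ +i* _ = f x)//; case: (f x).
Qed.

Lemma gs_bounded (f : GS R d) : exists C : R, forall x : V, `|f x| <= C%:C.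
Proof.
have [C _ fC] := gs_monom_le f; exists C => x.
have := fC (fun=> 0%N) x; rewrite /mindeg /monom !big1// mulr1.
by rewrite mul1r.
Qed.

Lemma gs_decay (f : GS R d) : exists C : R, forall x : V,
  `|f x| <= (C * \prod_(i < d) (oneDsqr (x 0 i))^-1)%:C.
Proof.
(* The exponent [a] chosen below varies with [x], but its degree is at most [d * 2], so this
   factorial serves all [x]. The power of 2 collects one factor per coordinate. *)
have [C C0 fC] := gs_monom_le f; exists (2 ^+ d * (C * (d * 2)`!%:R)) => x.
(* 1 + x^2 <= 2 x^a for a = 2 or a = 0, according as |x| >= 1 or not. *)
pose a (i : 'I_d) := if 1 <= `|x 0 i| then 2%N else 0%N.
have weight : \prod_(i < d) oneDsqr (x 0 i) <= 2 ^+ d * monom a x.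
  rewrite /monom -[X in 2 ^+ X]card_ord -prodr_const -big_split/=.
  apply: ler_prod => i _; rewrite (le_trans ler01 (oneDsqr_ge1 _)) /=.
  rewrite /a /oneDsqr mulrDl !mul1r; have [x1|/ltW x1] := leP 1 `|x 0 i|.
    by rewrite lerD2r -real_normK ?num_real// expr_ge1.
  by rewrite expr0 lerD2l -real_normK ?num_real// expr_le1.
have dega : (mindeg a <= d * 2)%N.
  rewrite -[X in (X * 2)%N]card_ord -sum_nat_const.
  by apply: leq_sum => i _; rewrite /a; case: ifP.
have weight_gt0 : 0 < \prod_(i < d) oneDsqr (x 0 i).
  by apply: prodr_gt0 => i _; rewrite (lt_le_trans _ (oneDsqr_ge1 _)).
have := fC a x.
(* Norms in [R[i]] are complex numbers; writing this one as a real square root brings the inequality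
   down to [R]. *)
have -> : `|f x| =
    (Num.sqrt (complex.Re (f x) ^+ 2 + complex.Im (f x) ^+ 2))%:C.
  exact: normc_def.
set n := Num.sqrt _.
have n0 : 0 <= n by exact: sqrtr_ge0.
rewrite normrM [X in _ * X]normc_def -/n normc_def /= expr0n addr0 sqrtr_sqr.
rewrite -rmorphM /= !lecR => fCx.
rewrite prodfV ler_pdivlMr//.
rewrite (le_trans (ler_wpM2l n0 weight))//.
rewrite mulrCA ler_wpM2l ?exprn_ge0// mulrC.
rewrite (le_trans (ler_wpM2r n0 (ler_norm _)))// (le_trans fCx)//.
by apply: ler_wpM2l; [exact: ltW|rewrite ler_nat leq_fact].
Qed.

End GelfandShilovDecay.

(** * Complex integrals and the relation between the two transforms *)

Section GrossmannRoyer.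
Context {R : realType} {d : nat}.
Local Notation RT := (measurableTypeR R).
Local Notation V := 'rV[R]_d.
Local Notation mu := (@lebesgue_tuple R d).
Local Open Scope complex_scope.
Implicit Types (F : V -> R[i]) (x w : V).

Definition cintegrable F :=
  mu.-integrable [set: d.-tuple RT]
    (fun t : d.-tuple RT => (complex.Re (F (\row_i tnth t i)))%:E) /\
  mu.-integrable [set: d.-tuple RT]
    (fun t : d.-tuple RT => (complex.Im (F (\row_i tnth t i)))%:E).

Lemma decay_cintegrable F (C : R) : ccontinuous F ->
  (forall t, `|F t| <= (C * \prod_(i < d) (oneDsqr (t 0 i))^-1)%:C) ->
  cintegrable F.
Proof.
move=> /ccontinuous_measurable[mr mi] FC.
have iW : mu.-integrable [set: d.-tuple RT]
    (fun t : d.-tuple RT => (C%:E * (tuple_weight t)%:E)%E).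
  exact: integrableZl (integrable_tuple_weight d).
(* The sign of [C] is arbitrary; the absolute value is the form that [le_integrable] compares
   with. *)
have FW (t : d.-tuple RT) : `|F (\row_i tnth t i)| <= `|C * tuple_weight t|%:C.
  apply: le_trans (FC _) _; rewrite lecR (le_trans _ (ler_norm _))//.
  by under eq_bigr do rewrite mxE.
split; apply: le_integrable iW => //.
- by apply/measurable_EFinP.
- by move=> t _; rewrite -EFinM lee_fin; exact/norm_Re_le/FW.
- by apply/measurable_EFinP.
- by move=> t _; rewrite -EFinM lee_fin; exact/norm_Im_le/FW.
Qed.

Lemma cintegralZl (k : R[i]) F : cintegrable F ->
  cintegral (fun t => k * F t) = k * cintegral F.
Proof.
case: k => p q [ir ii]; rewrite /cintegral.
have Zl (r : R) (g : d.-tuple RT -> R) :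
    mu.-integrable [set: d.-tuple RT] (fun t => (g t)%:E) ->
    mu.-integrable [set: d.-tuple RT] (fun t => (r * g t)%:E).
  exact: integrableZl.
(* The complex product is expanded into components, so that linearity of the real integral applies
   to each of the four terms. *)
transitivity ((p * \int[mu]_t complex.Re (F (\row_i tnth t i)) -
    q * \int[mu]_t complex.Im (F (\row_i tnth t i))) +i*
  (p * \int[mu]_t complex.Im (F (\row_i tnth t i)) +
    q * \int[mu]_t complex.Re (F (\row_i tnth t i)))); last by [].
rewrite -!RintegralZl//; rewrite -RintegralB//; last 2 first.
- exact: Zl.
- exact: Zl.
rewrite -RintegralD//; last 2 first.
- exact: Zl.
- exact: Zl.
by congr (_ +i* _); apply: eq_Rintegral => t _; case: (F _).
Qed.

Lemma cintegral_reflect x F : ccontinuous F ->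
  cintegral (fun t => F (x - t)) = cintegral F.
Proof.
move=> /ccontinuous_measurable[mr mi].
pose c : d.-tuple RT := [tuple x 0 i | i < d].
have E (t : d.-tuple RT) :
    x - \row_i tnth t i = \row_i tnth (tuple_reflect c t) i.
  by apply/rowP => j; rewrite !mxE !tnth_mktuple.
rewrite /cintegral; congr (fine _ +i* fine _).
  under eq_integral do rewrite E.
  by rewrite (integral_tuple_reflect c
    (g := fun t => (complex.Re (F (\row_i tnth t i)))%:E))//;
    apply/measurable_EFinP.
under eq_integral do rewrite E.
by rewrite (integral_tuple_reflect c
  (g := fun t => (complex.Im (F (\row_i tnth t i)))%:E))//;
  apply/measurable_EFinP.
Qed.

Lemma dotC x w : dot x w = dot w x.
Proof. by apply: eq_bigr => i _; rewrite mulrC. Qed.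

Lemma dotBl x (t : V) w : dot (x - t) w = dot x w - dot t w.
Proof. by rewrite /dot -sumrB; apply: eq_bigr => i _; rewrite !mxE mulrBl. Qed.

Lemma dotZl (k : R) x w : dot (k *: x) w = k * dot x w.
Proof. by rewrite /dot mulr_sumr; apply: eq_bigr => i _; rewrite mxE mulrA. Qed.

Lemma continuous_dot w : continuous (fun t : V => dot t w).
Proof.
rewrite /dot; apply: (continuous_big (@add_continuous R^o)) => i _ t.
apply: (@continuousM _ _ (fun t : V => t 0 i) (cst (w 0 i))).
  exact: coord_continuous.
exact: cst_continuous.
Qed.

Definition stft_kernel (phi f : V -> R[i]) x w (t : V) : R[i] :=
  expi (- (2 * pi * dot t w)) * f t * Num.conj (phi (t - x)).

Lemma stft_kernel_ccontinuous (phi f : GS R d) x w :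
  ccontinuous (stft_kernel phi f x w).
Proof.
apply: ccontinuousM; last first.
  apply: ccontinuous_conj.
  apply: (ccontinuous_comp (g := fun t : V => t - x));
    last exact: gs_ccontinuous.
  move=> t; apply: (@continuousB _ _ _ id (cst x)); first exact: cvg_id.
  exact: cst_continuous.
apply: ccontinuousM; last exact: gs_ccontinuous.
apply: ccontinuous_expi => t.
apply: (@continuousN _ _ _ (fun t : V => 2 * pi * dot t w)).
apply: (@continuousM _ _ (cst (2 * pi)) (fun t : V => dot t w)).
  exact: cst_continuous.
exact: continuous_dot.
Qed.

(** The phase is unimodular and the window bounded, so the decay of [f] alone dominates the
    kernel. *)
Lemma stft_kernel_cintegrable (phi f : GS R d) x w :
  cintegrable (stft_kernel phi f x w).
Proof.
have [C fC] := gs_decay f; have [M phiM] := gs_bounded phi.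
apply: (@decay_cintegrable _ (C * M)); first exact: stft_kernel_ccontinuous.
move=> t; rewrite /stft_kernel !normrM norm_expi mul1r norm_conjC.
by rewrite mulrAC rmorphM/= ler_pM.
Qed.

Lemma grossmann_royer_stft (phi f : GS R d) x w :
  grossmann_royer (reflection phi) f (2^-1 *: x) (2^-1 *: w) =
  expi (pi * dot w x) * stft phi f x w.
Proof.
have cK := stft_kernel_ccontinuous phi f x w.
rewrite -[stft _ _ _ _]/(cintegral (stft_kernel phi f x w)).
rewrite -cintegralZl; last exact: stft_kernel_cintegrable.
(* The substitution is made in the short-time Fourier integral, after which the two integrands agree
   pointwise. *)
rewrite -(cintegral_reflect x); last first.
  apply: ccontinuousM cK.
  by apply: (ccontinuous_expi (g := cst (pi * dot w x))); exact: cst_continuous.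
congr cintegral; apply/funext => t.
rewrite /grossmann_royer_op /reflection /stft_kernel.
rewrite scalerA divff ?scale1r ?pnatr_eq0// !mulrA -expiD.
congr (expi _ * _ * Num.conj (phi _)); last by rewrite addrAC subrr add0r.
(* Both phases equal [2 * pi * dot t w - pi * dot x w]. *)
rewrite dotZl (dotC w (t - _)) (dotC w x) !dotBl dotZl.
by field.
Qed.

End GrossmannRoyer.

Theorem lemma4 (R : realType) (d : nat) (f phi1 phi2 : GS R d)
    (a : gs_dual R (d + d)) :
  locop_grossmann_royer a phi1 phi2 f = locop_stft a phi1 phi2 f.
Proof.
apply/funext => g; rewrite /locop_grossmann_royer /locop_stft /mul_pairing.
(* Equal functions give equal values of [insubd], so a pointwise identity of the two products
   suffices. *)
congr (a (insubd _ _)); apply/funext => z.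
rewrite !grossmann_royer_stft rmorphM /= conj_expi mulrACA -expiD addNr expi0.
by rewrite mul1r.
Qed.
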